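(* Let $\alpha>0$ be irrational and let $z_{-1}\in\mathbb{C}$ be such that the greedy sequence $(z_n)$ with parameters $(\alpha,z_{-1})$ is defined for all $n\ge 0$. Let $w\in\mathbb{C}$ satisfy $$|w|<\frac12\inf_{n\ge 0}a_n=\frac12\inf_{n\ge0}\big||z_{n-1}+e^{2\pi i n\alpha}|-|z_{n-1}-e^{2\pi i n\alpha}|\big|.$$ Then replacing $z_{-1}$ by $z_{-1}+w$ shifts the entire sequence by $w$: the greedy sequence $(z_n')$ with parameters $(\alpha,z_{-1}+w)$ satisfies $z_n'=z_n+w$ for all $n\ge 0$.
   Context: Greedy sequence with parameters $(\alpha,z_{-1})$, where $\alpha>0$ is irrational and $z_{-1}\in\mathbb{C}$: for $n\ge 0$, $z_n=z_{n-1}+\varepsilon_n e^{2\pi i\alpha n}$ where the sign $\varepsilon_n\in\{-1,1\}$ is chosen so as to minimize $|z_n|$. If $|z_{n-1}+e^{2\pi i\alpha n}|=|z_{n-1}-e^{2\pi i\alpha n}|$ for some $n$, the sequence terminates at $z_{n-1}$ (neither $z_n$ nor $\varepsilon_n$, nor any later term, is defined). Ambiguity sequence: $a_n=\big||z_{n-1}+e^{2\pi i n\alpha}|-|z_{n-1}-e^{2\pi i n\alpha}|\big|$ for $n\ge 0$. *)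

(* Defs.v *)
(* Stdlib reals with Coquelicot's complex numbers and extended reals. *)
From Stdlib Require Import Reals QArith Qreals Lra.
From Coquelicot Require Import Coquelicot.
Open Scope R_scope.

Definition irrational (x : R) : Prop := forall q : Q, x <> Q2R q.

(* Coquelicot has no complex exponential: this is e^(i theta) for real theta,
   so that [phase alpha n] is e^(2 pi i alpha n). *)
Definition expi (theta : R) : C := (cos theta, sin theta).

Definition phase (alpha : R) (n : nat) : C := expi (2 * PI * alpha * INR n).

(* The sign e in {-1, 1} minimizing |z + e u|, and [None] in case of a tie;
   see [greedy_sign_spec]. *)
Definition greedy_sign (z u : C) : option R :=
  match total_order_T (Cmod (z + u)) (Cmod (z - u)) with
  | inleft (left _) => Some 1
  | inleft (right _) => None
  | inright _ => Some (-1)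
  end.

Lemma greedy_sign_spec (z u : C) (e : R) :
  greedy_sign z u = Some e <->
  Cmod (z + u) <> Cmod (z - u) /\
  (e = 1 \/ e = -1) /\
  (forall e' : R, e' = 1 \/ e' = -1 ->
     Cmod (z + RtoC e * u) <= Cmod (z + RtoC e' * u)).
Proof.
assert (Hp : (z + RtoC 1 * u)%C = (z + u)%C) by ring.
assert (Hm : (z + RtoC (-1) * u)%C = (z - u)%C)
  by (apply injective_projections; simpl; ring).
unfold greedy_sign.
destruct (total_order_T (Cmod (z + u)) (Cmod (z - u))) as [[H|H]|H]; split.
- intros E; injection E as <-; repeat split; [lra | now left |].
  intros e' [-> | ->]; rewrite ?Hp, ?Hm; lra.
- intros (_ & [-> | ->] & Hmin); [reflexivity | exfalso].
  generalize (Hmin 1 (or_introl eq_refl)); rewrite Hp, Hm; lra.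
- discriminate.
- intros (Hne & _); contradiction.
- intros E; injection E as <-; repeat split; [lra | now right |].
  intros e' [-> | ->]; rewrite ?Hp, ?Hm; lra.
- intros (_ & [-> | ->] & Hmin); [exfalso | reflexivity].
  generalize (Hmin (-1) (or_intror eq_refl)); rewrite Hp, Hm; lra.
Qed.

Definition greedy_step (z u : C) : option C :=
  option_map (fun e : R => (z + RtoC e * u)%C) (greedy_sign z u).

(* [greedy alpha zinit n] is the term z_n of the greedy sequence with
   z_{-1} = zinit, and [None] if the sequence has terminated before z_n. *)
Fixpoint greedy (alpha : R) (zinit : C) (n : nat) : option C :=
  match n with
  | O => greedy_step zinit (phase alpha 0)
  | S m =>
      match greedy alpha zinit m with
      | Some z => greedy_step z (phase alpha (S m))
      | None => None
      end
  end.

(* z_{n-1} for n >= 0, given z_{-1} = zinit and the terms z_0, z_1, ... *)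
Definition prev_term (zinit : C) (z : nat -> C) (n : nat) : C :=
  match n with
  | O => zinit
  | S m => z m
  end.

Definition ambiguity (alpha : R) (zinit : C) (z : nat -> C) (n : nat) : R :=
  Rabs (Cmod (prev_term zinit z n + phase alpha n)
        - Cmod (prev_term zinit z n - phase alpha n)).

(* Main.v *)
Require Import Defs.
From Stdlib Require Import Reals Lra.
From Coquelicot Require Import Coquelicot.
Open Scope R_scope.

(** The map [z |-> |z + u| - |z - u|], whose sign decides the greedy choice, is
    2-Lipschitz: each of the two moduli changes by at most [|w|] when [z] is
    replaced by [z + w].  The hypothesis on [w] says that [2|w|] is smaller than
    the absolute value of this difference at every term of the original
    sequence, so the shift by [w] never changes its sign
    ([greedy_sign_shift]).  Equal signs mean equal increments, so by induction
    the shifted sequence stays at the constant offset [w]. *)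

Lemma Inf_seq_lower_bound (u : nat -> Rbar) (n : nat) : Rbar_le (Inf_seq u) (u n).
Proof.
rewrite Inf_eq_glb; unfold Rbar_glb.
destruct (Rbar_ex_glb (fun x => exists n, x = u n)) as [l Hl]; simpl.
destruct Hl as [Hlb _].
apply Hlb; now exists n.
Qed.

Lemma Cmod_shift_bounds (z w : C) :
  Cmod z - Cmod w <= Cmod (z + w) <= Cmod z + Cmod w.
Proof.
split; [|apply Cmod_triangle].
assert (H := Cmod_triangle (z + w) (- w)).
replace (z + w + - w)%C with z in H by ring.
rewrite Cmod_opp in H; lra.
Qed.

(** The half-gap condition is exactly what the 2-Lipschitz bound allows; it also
    excludes ties, both at [z] and at [z + w]. *)
Lemma greedy_sign_shift (z u w : C) :
  2 * Cmod w < Rabs (Cmod (z + u) - Cmod (z - u)) ->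
  greedy_sign (z + w) u = greedy_sign z u.
Proof.
intros Hw.
assert (Hp := Cmod_shift_bounds (z + u) w).
assert (Hm := Cmod_shift_bounds (z - u) w).
replace (z + u + w)%C with (z + w + u)%C in Hp by ring.
replace (z - u + w)%C with (z + w - u)%C in Hm by ring.
assert (H0 := Cmod_ge_0 w).
unfold greedy_sign.
destruct (total_order_T (Cmod (z + w + u)) (Cmod (z + w - u))) as [[H|H]|H];
  destruct (total_order_T (Cmod (z + u)) (Cmod (z - u))) as [[H'|H']|H'];
  try reflexivity; exfalso; revert Hw; unfold Rabs; destruct Rcase_abs; lra.
Qed.

Lemma greedy_step_shift (z u w z' : C) :
  2 * Cmod w < Rabs (Cmod (z + u) - Cmod (z - u)) ->
  greedy_step z u = Some z' -> greedy_step (z + w) u = Some (z' + w)%C.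
Proof.
intros Hw; unfold greedy_step; rewrite (greedy_sign_shift _ _ _ Hw).
destruct (greedy_sign z u) as [e|]; simpl; [|discriminate].
intros E; injection E as <-; f_equal; ring.
Qed.

(** Passing from the extended-real infimum to a bound on each real term.  An
    infinite infimum is impossible: [p_infty] because the terms are finite,
    [m_infty] because half of it would have to exceed [x]. *)
Lemma lt_half_Inf_seq (x : R) (a : nat -> R) :
  Rbar_lt (Finite x)
    (Rbar_mult (Finite (1 / 2)) (Inf_seq (fun n => Finite (a n)))) ->
  forall n, 2 * x < a n.
Proof.
intros Hx n.
assert (Hn := Inf_seq_lower_bound (fun n => Finite (a n)) n).
destruct (Inf_seq (fun n => Finite (a n))) as [l| |]; simpl in Hn.
- simpl in Hx; lra.
- contradiction.
- revert Hx; unfold Rbar_mult, Rbar_mult'.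
  destruct (Rle_dec 0 (1 / 2)) as [H|H]; [|lra].
  destruct (Rle_lt_or_eq_dec 0 (1 / 2) H); [|lra].
  contradiction.
Qed.

Theorem proposition1 (alpha : R) (zinit : C) (z : nat -> C) (w : C)
    (alpha_pos : 0 < alpha) (alpha_irr : irrational alpha)
    (z_greedy : forall n : nat, greedy alpha zinit n = Some (z n))
    (w_small : Rbar_lt (Finite (Cmod w))
       (Rbar_mult (Finite (1 / 2))
          (Inf_seq (fun n : nat => Finite (ambiguity alpha zinit z n))))) :
  forall n : nat, greedy alpha (zinit + w)%C n = Some (z n + w)%C.
Proof.
assert (Hw := lt_half_Inf_seq _ _ w_small).
induction n as [|n IHn]; cbn [greedy].
- exact (greedy_step_shift _ _ _ _ (Hw 0%nat) (z_greedy 0%nat)).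
- rewrite IHn; apply (greedy_step_shift _ _ _ _ (Hw (S n))).
  assert (Hz := z_greedy (S n)).
  cbn [greedy] in Hz; now rewrite z_greedy in Hz.
Qed.
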